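(* Let $H$ be a Hopf algebra over a field $\Bbbk$ with bijective antipode $S$ and let $(A,\rho_A)$ be a right $H$-comodule algebra. The canonical separability morphism $\underline{B}:H\otimes H\to A\otimes H^{\mathrm{op}}$, $\underline{B}(h\otimes h')=1_A\otimes h'S^{-1}(h)$ (product in $H$), is part of a Frobenius pair $(\underline{B},\mathfrak{t})$ for $(A\otimes H^{\mathrm{op}},H,\psi)$ only if $H\cong\Bbbk$.
   Context: Everything is over a field $\Bbbk$, $\otimes=\otimes_{\Bbbk}$, algebras are associative and unital, and Sweedler notation with suppressed summation is used. $H$ is a Hopf algebra with counit $\varepsilon$ and antipode $S$; $H^{\mathrm{op}}$ is $H$ with opposite multiplication. A right $H$-comodule algebra $(A,\rho_A)$ is an algebra $A$ which is a right $H$-comodule via an algebra map $\rho_A:A\to A\otimes H$, $\rho_A(a)=a_0\otimes a_1$ (iterated: $a_0\otimes a_1\otimes a_2$, etc.). With $\psi:H\otimes A\otimes H^{\mathrm{op}}\to A\otimes H^{\mathrm{op}}\otimes H$, $\psi(h\otimes a\otimes l)=a_0\otimes l_1\otimes l_2ha_1$, one has a cowreath $(A\otimes H^{\mathrm{op}},H,\psi)$, i.e. $(H,\psi)$ is a coalgebra in the category of right transfer morphisms through $A\otimes H^{\mathrm{op}}$, with comultiplication $h\mapsto 1_A\otimes 1_H\otimes h_1\otimes h_2$ and counit $h\mapsto\varepsilon(h)1_A\otimes 1_H$. Convention: whenever a multiplication symbol is omitted, products in $A\otimes H$ are computed with the ordinary multiplications of $A$ and of $H$ (not the opposite one). A Casimir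 morphism for $(H,\psi)$ is a $\Bbbk$-linear map $B:H\otimes H\to A\otimes H^{\mathrm{op}}$, written $B(h\otimes h')=B^A(h\otimes h')\otimes B^H(h\otimes h')$, such that for all $a\in A$, $g,h,h'\in H$: $$(a_0\otimes 1_H)B(g_2ha_1\otimes g_3h'a_2)(1_A\otimes g_1)=(1_A\otimes g)B(h\otimes h')(a\otimes 1_H),$$ $$B^A(h_2\otimes h')_0\otimes B^H(h_2\otimes h')_1\otimes B^H(h_2\otimes h')_2h_1B^A(h_2\otimes h')_1=B(h\otimes h'_1)\otimes h'_2.$$ A Frobenius pair for the cowreath is a pair $(B,\mathfrak{t})$ consisting of a Casimir morphism $B$ and an element $\mathfrak{t}=\mathfrak{t}^1\otimes\mathfrak{t}^2\otimes\mathfrak{t}^3\in A\otimes H\otimes H$ such that for all $a\in A$, $h\in H$: $$a\mathfrak{t}^1\otimes\mathfrak{t}^2h\otimes\mathfrak{t}^3=\mathfrak{t}^1a_0\otimes h_1\mathfrak{t}^2\otimes h_2\mathfrak{t}^3a_1,$$ $$(\mathfrak{t}^1\otimes 1_H)B(\mathfrak{t}^3\otimes h)(1_A\otimes\mathfrak{t}^2)=\varepsilon(h)1_A\otimes 1_H=(\mathfrak{t}^1_0\otimes 1_H)B(\mathfrak{t}^2_2h\mathfrak{t}^1_1\otimes\mathfrak{t}^3)(1_A\otimes\mathfrak{t}^2_1).$$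
   Formalization: The comodule algebra A is assumed to be nonzero; for A = 0 every condition of a Frobenius pair holds trivially for any Hopf algebra H with bijective antipode, so the statement would fail. *)

(* Defs.v *)
From HB Require Import structures.
From mathcomp Require Import all_boot all_algebra generic_quotient.
From mathcomp Require Import boolp.

Set Implicit Arguments.
Unset Strict Implicit.
Unset Printing Implicit Defensive.

Import GRing.Theory.
Local Open Scope ring_scope.
Local Open Scope quotient_scope.

Reserved Notation "x ⊗ y" (at level 40, left associativity).
Reserved Notation "\sw_ ( u , v <- x ) E"
  (at level 41, u name, v name, x at level 50, E at level 41, right associativity,
   format "\sw_ ( u ,  v  <-  x )  E").
Reserved Notation "\sw_ ( u , v , w <- x ) E"
  (at level 41, u name, v name, w name, x at level 50, E at level 41,
   right associativity, format "\sw_ ( u ,  v ,  w  <-  x )  E").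

Section TensorProduct.
Variables (k : fieldType) (U V : lmodType k).

(* A list stands for the formal sum of its entries (u, v), read as u ⊗ v. *)
Inductive tensor_rel : seq (U * V) -> seq (U * V) -> Prop :=
| tensor_refl s : tensor_rel s s
| tensor_sym s t : tensor_rel s t -> tensor_rel t s
| tensor_trans s t r : tensor_rel s t -> tensor_rel t r -> tensor_rel s r
| tensor_cat s s' t t' :
    tensor_rel s s' -> tensor_rel t t' -> tensor_rel (s ++ t) (s' ++ t')
| tensor_catC s t : tensor_rel (s ++ t) (t ++ s)
| tensor_zero v : tensor_rel [:: (0, v)] [::]
| tensor_addl u u' v : tensor_rel [:: (u + u', v)] [:: (u, v); (u', v)]
| tensor_addr u v v' : tensor_rel [:: (u, v + v')] [:: (u, v); (u, v')]
| tensor_scale c u v : tensor_rel [:: (c *: u, v)] [:: (u, c *: v)].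

Definition tensor_relb (s t : seq (U * V)) : bool := `[< tensor_rel s t >].

Lemma tensor_relb_equiv : equiv_class_of tensor_relb.
Proof.
split=> [s|s t|t s r].
- by apply/asboolP; exact: tensor_refl.
- by apply/asboolP/asboolP; exact: tensor_sym.
- by move=> /asboolP st /asboolP tr; apply/asboolP; exact: tensor_trans tr.
Qed.

Canonical tensor_equiv := EquivRelPack tensor_relb_equiv.

Definition tensor := {eq_quot tensor_equiv}.

HB.instance Definition _ := Choice.on tensor.

Definition tensor_of (s : seq (U * V)) : tensor :=
  \pi_{eq_quot tensor_equiv} s.
Definition tensor_rep (x : tensor) : seq (U * V) :=
  repr (x : {eq_quot tensor_equiv}).

Lemma tensor_repK : cancel tensor_rep tensor_of.
Proof. exact: reprK. Qed.

Lemma tensor_eqP s t : (tensor_of s = tensor_of t) <-> tensor_rel s t.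
Proof.
split=> [st|/asboolP st].
  by apply/asboolP; exact/(@eqquotP _ tensor_relb {eq_quot tensor_equiv}).
exact/(@eqquotP _ tensor_relb {eq_quot tensor_equiv}).
Qed.

Lemma tensor_repP s : tensor_rel (tensor_rep (tensor_of s)) s.
Proof. by apply/tensor_eqP; rewrite tensor_repK. Qed.

Definition tensor0 : tensor := tensor_of [::].
Definition tensorD (x y : tensor) : tensor := tensor_of (tensor_rep x ++ tensor_rep y).
Definition tensorZ (c : k) (x : tensor) : tensor :=
  tensor_of [seq (c *: p.1, p.2) | p <- tensor_rep x].
Definition tensorN (x : tensor) : tensor := tensorZ (-1) x.

Lemma tensorD_of s t : tensorD (tensor_of s) (tensor_of t) = tensor_of (s ++ t).
Proof. by apply/tensor_eqP; apply: tensor_cat; exact: tensor_repP. Qed.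

Lemma tensor_rel_map c s t : tensor_rel s t ->
  tensor_rel [seq (c *: p.1, p.2) | p <- s] [seq (c *: p.1, p.2) | p <- t].
Proof.
elim=> {s t} /=.
- by move=> s; exact: tensor_refl.
- by move=> s t _; exact: tensor_sym.
- by move=> s t r _ st _; exact: tensor_trans.
- by move=> s s' t t' _ ss' _ tt'; rewrite !map_cat; exact: tensor_cat.
- by move=> s t; rewrite !map_cat; exact: tensor_catC.
- by move=> v; rewrite scaler0; exact: tensor_zero.
- by move=> u u' v; rewrite scalerDr; exact: tensor_addl.
- by move=> u v v'; exact: tensor_addr.
- move=> d u v; rewrite scalerA mulrC -scalerA.
  exact: tensor_scale.
Qed.

Lemma tensorZ_of c s :
  tensorZ c (tensor_of s) = tensor_of [seq (c *: p.1, p.2) | p <- s].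
Proof. by apply/tensor_eqP; apply: tensor_rel_map; exact: tensor_repP. Qed.

Lemma tensorDA : associative tensorD.
Proof.
move=> x y z; rewrite -[x]tensor_repK -[y]tensor_repK -[z]tensor_repK.
by rewrite !tensorD_of catA.
Qed.

Lemma tensorDC : commutative tensorD.
Proof.
move=> x y; rewrite -[x]tensor_repK -[y]tensor_repK !tensorD_of.
by apply/tensor_eqP; exact: tensor_catC.
Qed.

Lemma tensor0D : left_id tensor0 tensorD.
Proof. by move=> x; rewrite -[x]tensor_repK tensorD_of. Qed.

Lemma tensor_of_cons p s :
  tensor_of (p :: s) = tensorD (tensor_of [:: p]) (tensor_of s).
Proof. by rewrite tensorD_of. Qed.

Lemma tensorZDr c : {morph tensorZ c : x y / tensorD x y}.
Proof.
move=> x y; rewrite -[x]tensor_repK -[y]tensor_repK.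
by rewrite tensorD_of !tensorZ_of tensorD_of map_cat.
Qed.

Lemma tensorZDl x : {morph tensorZ^~ x : c d / c + d >-> tensorD c d}.
Proof.
move=> c d /=; rewrite -[x]tensor_repK; elim: (tensor_rep x) => [|[u v] s IH].
  by rewrite !tensorZ_of /= tensorD_of.
rewrite tensor_of_cons !tensorZDr IH !tensorDA; congr tensorD.
rewrite -!tensorDA [tensorD _ (tensorZ d _)]tensorDC !tensorDA; congr tensorD.
rewrite !tensorZ_of /= tensorD_of; apply/tensor_eqP.
by rewrite scalerDl; exact: tensor_addl.
Qed.

Lemma tensor0Z x : tensorZ 0 x = tensor0.
Proof.
rewrite -[x]tensor_repK; elim: (tensor_rep x) => [|[u v] s IH]; first by rewrite tensorZ_of.
rewrite tensor_of_cons tensorZDr IH tensorDC tensor0D tensorZ_of /= scale0r.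
by apply/tensor_eqP; exact: tensor_zero.
Qed.

Lemma tensor1Z : left_id 1 tensorZ.
Proof.
move=> x; rewrite -[x]tensor_repK tensorZ_of; congr tensor_of.
by rewrite -[RHS]map_id; apply: eq_map => -[u v]; rewrite scale1r.
Qed.

Lemma tensorNx : left_inverse tensor0 tensorN tensorD.
Proof.
by move=> x; rewrite -{2}[x]tensor1Z -tensorZDl addNr tensor0Z.
Qed.

HB.instance Definition _ :=
  GRing.isZmodule.Build tensor tensorDA tensorDC tensor0D tensorNx.

Lemma tensorZA c d x : tensorZ c (tensorZ d x) = tensorZ (c * d) x.
Proof.
rewrite -[x]tensor_repK !tensorZ_of -map_comp; congr tensor_of.
by apply: eq_map => -[u v] /=; rewrite scalerA.
Qed.

HB.instance Definition _ := GRing.Zmodule_isLmodule.Build k tensor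
  tensorZA tensor1Z tensorZDr tensorZDl.

Lemma tensor_ofD s t : tensor_of (s ++ t) = tensor_of s + tensor_of t.
Proof. by rewrite -tensorD_of. Qed.

Lemma tensor_ofZ c s :
  tensor_of [seq (c *: p.1, p.2) | p <- s] = c *: tensor_of s.
Proof. by rewrite -tensorZ_of. Qed.

Definition ptensor (u : U) (v : V) : tensor := tensor_of [:: (u, v)].

Lemma ptensor_bilinear : bilinear_for *:%R *:%R ptensor.
Proof.
split=> [v c u u'|u c v v'] /=; rewrite /ptensor -tensor_ofZ -tensor_ofD;
  apply/tensor_eqP => /=; first exact: tensor_addl.
apply: (tensor_trans (tensor_addr _ _ _)).
apply: (@tensor_cat [:: _] [:: _] [:: _] [:: _]); last exact: tensor_refl.
exact/tensor_sym/tensor_scale.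
Qed.

HB.instance Definition _ :=
  bilinear_isBilinear.Build k U V tensor _ _ ptensor ptensor_bilinear.

Lemma tensor_repr_sum (x : tensor) : x = \sum_(p <- tensor_rep x) ptensor p.1 p.2.
Proof.
rewrite -{1}[x]tensor_repK; elim: (tensor_rep x) => [|[u v] s IH]; first by rewrite big_nil.
by rewrite big_cons -IH (tensor_ofD [:: _]) /ptensor -surjective_pairing.
Qed.

Lemma tensor_ind (P : tensor -> Prop) :
  P 0 -> (forall u v x, P x -> P (ptensor u v + x)) -> forall x, P x.
Proof.
move=> P0 PD x; rewrite [x]tensor_repr_sum.
by elim: (tensor_rep x) => [|p s IH]; rewrite ?big_nil ?big_cons //; exact: PD.
Qed.

End TensorProduct.

Notation "U ⊗ V" := (tensor U V) : type_scope.
Notation "u ⊗ v" := (ptensor u v) : ring_scope.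

(* Sweedler's suppressed summation: write x = \sum u ⊗ v, with the same finite *)
(* sum for all occurrences of u and v, and return \sum (f u v).  The summand   *)
(* is always bilinear, which makes the result independent of the expression    *)
(* of x (sweedler_ptensor) and equal to the value at x of the linear map       *)
(* induced by f on the tensor product (sweedler_linear, sweedler_unique).      *)
Definition sweedler (k : fieldType) (U V W : lmodType k) (x : U ⊗ V)
  (f : U -> V -> W) : W := \sum_(p <- tensor_rep x) f p.1 p.2.

Notation "\sw_ ( u , v <- x ) E" := (sweedler x (fun u v => E)) : ring_scope.
Notation "\sw_ ( u , v , w <- x ) E" :=
  (sweedler x (fun uv w => sweedler uv (fun u v => E))) : ring_scope.

Section UniversalProperty.
Variables (k : fieldType) (U V W : lmodType k) (f : U -> V -> W).
Hypothesis fB : bilinear_for *:%R *:%R f.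

Let f0l v : f 0 v = 0.
Proof. by have /= := fB.1 v (-1) 0 0; rewrite scaler0 addr0 scaleN1r addNr. Qed.

Let fDl u u' v : f (u + u') v = f u v + f u' v.
Proof. by have /= := fB.1 v 1 u u'; rewrite !scale1r. Qed.

Let fDr u v v' : f u (v + v') = f u v + f u v'.
Proof. by have /= := fB.2 u 1 v v'; rewrite !scale1r. Qed.

Let f0r u : f u 0 = 0.
Proof. by have /= := fB.2 u (-1) 0 0; rewrite scaler0 addr0 scaleN1r addNr. Qed.

Let fZl c u v : f (c *: u) v = c *: f u v.
Proof. by have /= := fB.1 v c u 0; rewrite f0l !addr0. Qed.

Let fZr c u v : f u (c *: v) = c *: f u v.
Proof. by have /= := fB.2 u c v 0; rewrite f0r !addr0. Qed.

Lemma sweedler_rel (s t : seq (U * V)) : tensor_rel s t ->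
  \sum_(p <- s) f p.1 p.2 = \sum_(p <- t) f p.1 p.2.
Proof.
elim=> {s t} //=.
- by move=> s t r _ -> _.
- by move=> s s' t t' _ ss' _ tt'; rewrite !big_cat /= ss' tt'.
- by move=> s t; rewrite !big_cat /= addrC.
- by move=> v; rewrite big_seq1 big_nil f0l.
- by move=> u u' v; rewrite !big_cons !big_nil /= !addr0 fDl.
- by move=> u v v'; rewrite !big_cons !big_nil /= !addr0 fDr.
- by move=> c u v; rewrite !big_seq1 /= fZl fZr.
Qed.

Lemma sweedler_ptensor u v : sweedler (u ⊗ v) f = f u v.
Proof. by rewrite /sweedler (sweedler_rel (tensor_repP _)) big_seq1. Qed.

Lemma sweedler_linear : linear (fun x : U ⊗ V => sweedler x f).
Proof.
move=> c x y; rewrite /sweedler.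
set lhs := \sum_(p <- tensor_rep (_ + _)) _.
have -> : lhs = \sum_(p <- [seq (c *: p.1, p.2) | p <- tensor_rep x]
                          ++ tensor_rep y) f p.1 p.2.
  apply: sweedler_rel; rewrite -{1}[x]tensor_repK -{1}[y]tensor_repK.
  by rewrite -tensor_ofZ -tensor_ofD; exact: tensor_repP.
rewrite big_cat big_map scaler_sumr; congr (_ + _).
by apply: eq_bigr => p _; rewrite /= fZl.
Qed.

Lemma sweedler_unique (g : {linear (U ⊗ V)%type -> W}) :
  (forall u v, g (u ⊗ v) = f u v) -> forall x, g x = sweedler x f.
Proof.
move=> gf x; rewrite {1}[x]tensor_repr_sum linear_sum.
by apply: eq_bigr => p _; exact: gf.
Qed.

End UniversalProperty.


Lemma sweedler_linear_fun (k : fieldType) (U V W : lmodType k) (c : k)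
    (F G K : U -> V -> W) (x : U ⊗ V) :
  (forall u v, F u v = c *: G u v + K u v) ->
  sweedler x F = c *: sweedler x G + sweedler x K.
Proof.
move=> FE; rewrite /sweedler scaler_sumr -big_split.
by apply: eq_bigr => p _; exact: FE.
Qed.

Section TensorAlgebra.
Variables (k : fieldType) (A B : algType k).
Local Notation T := (A ⊗ B)%type.

Definition tensor_mul (x y : T) : T :=
  \sw_(a, b <- x) \sw_(a', b' <- y) ((a * a') ⊗ (b * b')).

Let mulB a b : bilinear_for *:%R *:%R
  (fun (a' : A) (b' : B) => (a * a') ⊗ (b * b') : T).
Proof.
split=> [b' c u u'|a' c v v'] /=.
  by rewrite mulrDr -scalerAr linearPl.
by rewrite mulrDr -scalerAr linearPr.
Qed.

Let mulB2 y : bilinear_for *:%R *:%R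
  (fun (a : A) (b : B) => \sw_(a', b' <- y) ((a * a') ⊗ (b * b')) : T).
Proof.
split=> [b c u u'|a c v v'] /=; apply: sweedler_linear_fun => a' b'.
  by rewrite mulrDl -scalerAl linearPl.
by rewrite mulrDl -scalerAl linearPr.
Qed.

Lemma tensor_mul_bilinear : bilinear_for *:%R *:%R tensor_mul.
Proof.
split=> [y|x] c u v /=; first exact: (sweedler_linear (mulB2 y)).
apply: sweedler_linear_fun => a b; exact: (sweedler_linear (mulB a b)).
Qed.

HB.instance Definition _ :=
  bilinear_isBilinear.Build k T T T _ _ tensor_mul tensor_mul_bilinear.

Lemma tensor_mulE a b a' b' :
  tensor_mul (a ⊗ b) (a' ⊗ b') = (a * a') ⊗ (b * b').
Proof.
by rewrite /tensor_mul (sweedler_ptensor (mulB2 _)) (sweedler_ptensor (mulB _ _)).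
Qed.

Lemma tensor_mulDl : left_distributive tensor_mul +%R.
Proof. by move=> x y z; exact: linearDl. Qed.

Lemma tensor_mulDr : right_distributive tensor_mul +%R.
Proof. by move=> x y z; exact: linearDr. Qed.

Let mul0x x : tensor_mul 0 x = 0.
Proof. exact: linear0l. Qed.

Let mulx0 x : tensor_mul x 0 = 0.
Proof. exact: linear0r. Qed.

Lemma tensor_mulA : associative tensor_mul.
Proof.
move=> x y z; elim/tensor_ind: x => [|a b x IHx]; first by rewrite !mul0x.
rewrite !tensor_mulDl IHx; congr (_ + _) => {x IHx}.
elim/tensor_ind: y => [|a' b' y IHy]; first by rewrite mul0x !mulx0 mul0x.
rewrite tensor_mulDl !tensor_mulDr tensor_mulDl IHy; congr (_ + _) => {y IHy}.
elim/tensor_ind: z => [|a'' b'' z IHz]; first by rewrite !mulx0.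
by rewrite !tensor_mulDr IHz; congr (_ + _); rewrite !tensor_mulE !mulrA.
Qed.

Lemma tensor_mul1x : left_id (1 ⊗ 1) tensor_mul.
Proof.
elim/tensor_ind => [|a b x IHx]; first exact: mulx0.
by rewrite tensor_mulDr IHx tensor_mulE !mul1r.
Qed.

Lemma tensor_mulx1 : right_id (1 ⊗ 1) tensor_mul.
Proof.
elim/tensor_ind => [|a b x IHx]; first exact: mul0x.
by rewrite tensor_mulDl IHx tensor_mulE !mulr1.
Qed.

HB.instance Definition _ := GRing.Zmodule_isPzRing.Build T
  tensor_mulA tensor_mul1x tensor_mulx1 tensor_mulDl tensor_mulDr.

End TensorAlgebra.

HB.mixin Record Lmodule_isCoalgebra (k : fieldType) (C : Type)
    of GRing.Lmodule k C := {
  comul : {linear C -> (C ⊗ C)%type};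
  counit : {scalar C};
  comulA : forall x,
    \sw_(y, z <- comul x) \sw_(u, v <- comul y) (u ⊗ (v ⊗ z)) =
    \sw_(u, y <- comul x) \sw_(v, z <- comul y) (u ⊗ (v ⊗ z));
  counitl : forall x, \sw_(u, v <- comul x) (counit u *: v) = x;
  counitr : forall x, \sw_(u, v <- comul x) (counit v *: u) = x
}.
#[short(type="coalgType")]
HB.structure Definition Coalgebra (k : fieldType) :=
  {C of GRing.Lmodule k C & Lmodule_isCoalgebra k C}.

HB.mixin Record Coalgebra_isBialgebra (k : fieldType) (B : Type)
    of GRing.Algebra k B & Coalgebra k B := {
  comul_monoid_morphism : monoid_morphism (comul : B -> (B ⊗ B)%type);
  counit_monoid_morphism : monoid_morphism (counit : B -> k)
}.
#[short(type="bialgType")]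
HB.structure Definition Bialgebra (k : fieldType) :=
  {B of GRing.Algebra k B & Coalgebra k B & Coalgebra_isBialgebra k B}.

HB.mixin Record Bialgebra_isHopf (k : fieldType) (H : Type)
    of Bialgebra k H := {
  antipode : {linear H -> H};
  antipodel : forall x : H,
    \sw_(u, v <- comul x) (antipode u * v) = (counit x)%:A;
  antipoder : forall x : H,
    \sw_(u, v <- comul x) (u * antipode v) = (counit x)%:A
}.
#[short(type="hopfAlgType")]
HB.structure Definition HopfAlgebra (k : fieldType) :=
  {H of Bialgebra k H & Bialgebra_isHopf k H}.

HB.mixin Record Lmodule_isComodule (k : fieldType) (C : coalgType k) (M : Type)
    of GRing.Lmodule k M := {
  coact : {linear M -> (M ⊗ C)%type};
  coactA : forall x,
    \sw_(y, d <- coact x) \sw_(m, c <- coact y) (m ⊗ (c ⊗ d)) =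
    \sw_(m, y <- coact x) \sw_(c, d <- comul y) (m ⊗ (c ⊗ d));
  coact_counit : forall x, \sw_(m, c <- coact x) (counit c *: m) = x
}.
#[short(type="comodType")]
HB.structure Definition Comodule (k : fieldType) (C : coalgType k) :=
  {M of GRing.Lmodule k M & Lmodule_isComodule k C M}.

HB.mixin Record Comodule_isComodAlgebra (k : fieldType) (H : hopfAlgType k)
    (A : Type) of GRing.Algebra k A & Comodule k H A := {
  coact_monoid_morphism : monoid_morphism (coact : A -> (A ⊗ H)%type)
}.
(* Being an algType, a comodule algebra is nonzero (1 != 0); the zero algebra   *)
(* is a degenerate case in which all identities between tensors are void.      *)
#[short(type="comodAlgType")]
HB.structure Definition ComodAlgebra (k : fieldType) (H : hopfAlgType k) :=
  {A of GRing.Algebra k A & Comodule k H A & Comodule_isComodAlgebra k H A}.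

Section GroundFieldHopf.
Variable k : fieldType.
Local Notation K := (k^o).

Definition ground_comul (c : K) : (K ⊗ K)%type :=
  (c : k) *: ((1 : K) ⊗ (1 : K) : (K ⊗ K)%type).

Lemma ground_comul_linear : linear ground_comul.
Proof. by move=> c x y; rewrite /ground_comul scalerDl -scalerA. Qed.

HB.instance Definition _ := GRing.isLinear.Build k K (K ⊗ K)%type _
  ground_comul ground_comul_linear.

Definition ground_counit (c : K) : k := c.

Lemma ground_counit_linear : scalar ground_counit.
Proof. by []. Qed.

HB.instance Definition _ := GRing.isLinear.Build k K k _
  ground_counit ground_counit_linear.

Lemma ground_sweedler (W : lmodType k) (f : K -> K -> W) x :
  bilinear_for *:%R *:%R f -> sweedler (ground_comul x) f = x *: f 1 1.
Proof.
move=> fB; have := sweedler_linear fB x (1 ⊗ 1) 0.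
rewrite addr0 /= -/(ground_comul x) => ->; rewrite (sweedler_ptensor fB).
by have /= := sweedler_linear fB (-1) 0 0; rewrite scaler0 addr0 scaleN1r addNr
  => ->; rewrite addr0.
Qed.

Lemma ground_comulA x :
  \sw_(y, z <- ground_comul x) \sw_(u, v <- ground_comul y) (u ⊗ (v ⊗ z)) =
  \sw_(u, y <- ground_comul x) \sw_(v, z <- ground_comul y) (u ⊗ (v ⊗ z))
  :> (K ⊗ (K ⊗ K))%type.
Proof.
have B1 z : bilinear_for *:%R *:%R (fun u v : K => u ⊗ (v ⊗ z) : (K ⊗ (K ⊗ K))%type).
  by split=> [w|w] c u v /=; rewrite ?linearPl ?linearPr.
have B2 u : bilinear_for *:%R *:%R (fun v z : K => u ⊗ (v ⊗ z) : (K ⊗ (K ⊗ K))%type).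
  by split=> [w|w] c v z /=; rewrite ?(linearPl, linearPr).
rewrite !ground_sweedler //.
- split=> [w|w] c u v /=; rewrite !ground_sweedler //.
    by rewrite linearPl scalerDr !scalerA mulrC.
  by rewrite scalerDl -scalerA.
- split=> [w|w] c u v /=; rewrite !ground_sweedler //.
    by rewrite scalerDl -scalerA.
  by rewrite !linearPr scalerDr !scalerA mulrC.
Qed.

Lemma ground_counitl x :
  \sw_(u, v <- ground_comul x) (ground_counit u *: v) = x.
Proof.
rewrite ground_sweedler ?scale1r; first exact: mulr1.
split=> [w|w] c u v /=; first by rewrite linearP scalerDl -scalerA.
by rewrite scalerDr !scalerA mulrC.
Qed.

Lemma ground_counitr x :
  \sw_(u, v <- ground_comul x) (ground_counit v *: u) = x.
Proof.
rewrite ground_sweedler ?scale1r; first exact: mulr1.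
split=> [w|w] c u v /=; last by rewrite linearP scalerDl -scalerA.
by rewrite scalerDr !scalerA mulrC.
Qed.

HB.instance Definition _ := Lmodule_isCoalgebra.Build k K
  ground_comulA ground_counitl ground_counitr.

Lemma ground_comul_monoid_morphism :
  monoid_morphism (comul : K -> (K ⊗ K)%type).
Proof.
split=> [|x y]; first exact: scale1r.
have comulE (c : K) : comul c = c ⊗ (1 : K).
  by rewrite /comul /= /ground_comul -linearZl /= [_ *: _]mulr1.
rewrite !comulE; apply/esym; apply: etrans (tensor_mulE _ _ _ _) _.
by rewrite mulr1.
Qed.

Lemma ground_counit_monoid_morphism : monoid_morphism (counit : K -> k).
Proof. by []. Qed.

HB.instance Definition _ := Coalgebra_isBialgebra.Build k K
  ground_comul_monoid_morphism ground_counit_monoid_morphism.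

Let ground_mul_bilinear : bilinear_for *:%R *:%R (fun x y : K => x * y).
Proof.
by split=> [w|w] c u v; rewrite /= ?mulrDl ?mulrDr -?scalerAl -?scalerAr.
Qed.

Lemma ground_antipodel (x : K) :
  \sw_(u, v <- comul x) ((idfun : {linear K -> K}) u * v) = (counit x)%:A.
Proof. by rewrite [LHS](ground_sweedler _ ground_mul_bilinear) /= mulr1. Qed.

Lemma ground_antipoder (x : K) :
  \sw_(u, v <- comul x) (u * (idfun : {linear K -> K}) v) = (counit x)%:A.
Proof. exact: ground_antipodel. Qed.

HB.instance Definition _ := Bialgebra_isHopf.Build k K
  ground_antipodel ground_antipoder.

End GroundFieldHopf.

Definition is_hopf_iso (k : fieldType) (H K : hopfAlgType k)
    (f : {lrmorphism H -> K}) : Prop :=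
  [/\ bijective f,
      forall x, comul (f x) = \sw_(u, v <- comul x) (f u ⊗ f v),
      forall x, counit (f x) = counit x
    & forall x, antipode (f x) = f (antipode x)].

Definition hopf_isomorphic (k : fieldType) (H K : hopfAlgType k) : Prop :=
  exists f : {lrmorphism H -> K}, is_hopf_iso f.

Section AntipodeInverse.
Variables (k : fieldType) (H : hopfAlgType k).
Hypothesis Sbij : bijective (antipode : H -> H).

Lemma antipode_surj (y : H) : exists x : H, antipode x == y.
Proof. by have [S' _ S'K] := Sbij; exists (S' y); rewrite S'K. Qed.

Definition antipodeV (y : H) : H := xchoose (antipode_surj y).

Lemma antipodeVK : cancel antipodeV antipode.
Proof. by move=> y; apply/eqP; exact: (xchooseP (antipode_surj y)). Qed.

Lemma antipodeK : cancel antipode antipodeV.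
Proof. by move=> x; apply: (bij_inj Sbij); rewrite antipodeVK. Qed.

Lemma antipodeV_linear : linear antipodeV.
Proof.
by move=> c x y; apply: (bij_inj Sbij); rewrite linearP !antipodeVK.
Qed.

End AntipodeInverse.

Section Frobenius.
Variables (k : fieldType) (H : hopfAlgType k) (A : comodAlgType H).

(* g_1 ⊗ g_2 ⊗ g_3 and a_0 ⊗ a_1 ⊗ a_2 *)
Definition comul2 (g : H) : (H ⊗ H ⊗ H)%type :=
  \sw_(u, v <- comul g) (comul u ⊗ v).
Definition coact2 (a : A) : (A ⊗ H ⊗ H)%type :=
  \sw_(b, v <- coact a) (coact b ⊗ v).

(* A ⊗ H^op and A ⊗ H have the same underlying vector space.  The products     *)
(* occurring below are those of H, not of H^op, so A ⊗ H is used throughout.   *)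
Definition is_casimir (B : {linear (H ⊗ H)%type -> (A ⊗ H)%type}) : Prop :=
  (forall (a : A) (g h h' : H),
     \sw_(a0, a1, a2 <- coact2 a) \sw_(g1, g2, g3 <- comul2 g)
       ((a0 ⊗ 1) * B ((g2 * h * a1) ⊗ (g3 * h' * a2)) * (1 ⊗ g1))
     = (1 ⊗ g) * B (h ⊗ h') * (a ⊗ 1))
  /\
  (forall h h' : H,
     \sw_(h1, h2 <- comul h) \sw_(b, l <- B (h2 ⊗ h'))
       \sw_(b0, b1 <- coact b) \sw_(l1, l2 <- comul l)
         (b0 ⊗ l1 ⊗ (l2 * h1 * b1))
     = \sw_(h'1, h'2 <- comul h') (B (h ⊗ h'1) ⊗ h'2)).

Definition is_frobenius_pair (B : {linear (H ⊗ H)%type -> (A ⊗ H)%type})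
    (t : (A ⊗ H ⊗ H)%type) : Prop :=
  [/\ is_casimir B,
      forall (a : A) (h : H),
        \sw_(t1, t2, t3 <- t) ((a * t1) ⊗ (t2 * h) ⊗ t3)
        = \sw_(t1, t2, t3 <- t) \sw_(a0, a1 <- coact a) \sw_(h1, h2 <- comul h)
            ((t1 * a0) ⊗ (h1 * t2) ⊗ (h2 * t3 * a1)),
      forall h : H,
        \sw_(t1, t2, t3 <- t) ((t1 ⊗ 1) * B (t3 ⊗ h) * (1 ⊗ t2))
        = counit h *: (1 ⊗ 1)
    & forall h : H,
        \sw_(t1, t2, t3 <- t) \sw_(t10, t11 <- coact t1)
          \sw_(t21, t22 <- comul t2)
            ((t10 ⊗ 1) * B ((t22 * h * t11) ⊗ t3) * (1 ⊗ t21))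
        = counit h *: (1 ⊗ 1)].

Section Canonical.
Hypothesis Sbij : bijective (antipode : H -> H).

Definition canonical_separability (x : (H ⊗ H)%type) : (A ⊗ H)%type :=
  \sw_(h, h' <- x) (1 ⊗ (h' * antipodeV Sbij h)).

Lemma canonical_separability_bilinear : bilinear_for *:%R *:%R
  (fun h h' : H => 1 ⊗ (h' * antipodeV Sbij h) : (A ⊗ H)%type).
Proof.
split=> [h'|h] c u v /=.
  by rewrite antipodeV_linear mulrDr -scalerAr linearPr.
by rewrite mulrDl -scalerAl linearPr.
Qed.

HB.instance Definition _ :=
  GRing.isLinear.Build k (H ⊗ H)%type (A ⊗ H)%type _ canonical_separability
    (sweedler_linear canonical_separability_bilinear).

Lemma canonical_separabilityE h h' :
  canonical_separability (h ⊗ h') = 1 ⊗ (h' * antipodeV Sbij h).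
Proof. exact: (sweedler_ptensor canonical_separability_bilinear). Qed.

End Canonical.
End Frobenius.

Arguments canonical_separability {k H} A Sbij x.

(* Main.v *)
(* Evaluating the first normalisation condition of a Frobenius pair for the     *)
(* canonical morphism at h and at 1 gives, in A ⊗ H,                            *)
(*   counit h *: (1 ⊗ 1) = t1 ⊗ (h * S^-1(t3) * t2)                             *)
(*     = (1 ⊗ h) * (t1 ⊗ (S^-1(t3) * t2)) = 1 ⊗ h.                              *)
(* Since 1 != 0 in A, the map h |-> 1 ⊗ h is injective over a field, whence     *)
(* h = (counit h)%:A for all h, so the counit is an isomorphism H -> k.         *)
Require Import Defs.
From HB Require Import structures.
From mathcomp Require Import all_boot all_algebra.
From mathcomp Require Import boolp classical_sets.
Import GRing.Theory.
Local Open Scope ring_scope.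

(** The left side of the first normalisation is left [H]-linear in [h], since the canonical morphism
    puts [h] leftmost in the [H] leg; so its value at [1] forces [1 ⊗ h] to equal
    [counit h *: (1 ⊗ 1)]. Cancelling the factor [1] of [A] is [ptensor_eq0], which needs a
    functional nonzero on a given vector, supplied by Zorn in [exists_scalar_eq1].
    [hopf_isomorphic_ground] then makes the counit an isomorphism. *)

Lemma exists_scalar_eq1 (k : fieldType) (V : lmodType k) (v : V) :
  v != 0 -> exists phi : {scalar V}, phi v = 1.
Proof.
move=> v0.
pose P (X : set V) := (forall c x y, X x -> X y -> X (c *: x + y)) /\ ~ X v.
have [F FP Ftot|M [[Mlin Mv] Mmax]] := @Zorn_bigcup V P.
  split=> [c x y [X FX Xx] [Y FY Yy]|[X FX Xv]]; last by case: (FP _ FX).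
  have [XY|YX] := Ftot _ _ FX FY.
    by exists Y => //; apply: (FP _ FY).1 => //; exact: XY.
  by exists X => //; apply: (FP _ FX).1 => //; exact: YX.
(* P also holds of the empty set (the union of the empty chain), so 0 \in M   *)
(* needs an argument.  M is then a hyperplane complementary to the line of v.  *)
have M0 : M 0.
  apply: contrapT => nM0; apply: (Mmax [set 0]%classic).
    split=> [x Mx|/(_ 0 erefl)//]; exfalso; apply: nM0.
    by have := Mlin (-1) x x Mx Mx; rewrite scaleN1r addNr.
  by split=> [c _ _ -> ->|/= /eqP]; rewrite ?scaler0 ?addr0 //; apply/negP.
have MZ c x : M x -> M (c *: x) by move=> Mx; rewrite -[_ *: _]addr0; exact: Mlin.
have coord x : exists c, M (x - c *: v).
  have [Mx|nMx] := pselect (M x); first by exists 0; rewrite scale0r subr0.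
  (* [N] is [M] enlarged by the line of [x]. By maximality it contains [v], and solving for [x]
     gives its coordinate along [v]. *)
  pose N : set V := [set y | exists c, M (y - c *: x)]%classic.
  have [[c Mvc]|nNv] := pselect (N v).
    have c0 : c != 0 by apply: contra_notN Mv => /eqP c0; rewrite c0 scale0r subr0 in Mvc.
    exists c^-1; have := MZ (- c^-1) _ Mvc.
    by rewrite scalerBr scalerA mulNr mulVf // !scaleNr scale1r opprK addrC.
  exfalso; apply: (Mmax N); last split=> //.
    split=> [y My|NM]; first by exists 0; rewrite scale0r subr0.
    by apply/nMx/NM; exists 1; rewrite scale1r subrr.
  move=> c y z [d Md] [e Me]; exists (c * d + e).
  have := Mlin c _ _ Md Me.
  by rewrite scalerBr scalerDl -scalerA addrACA opprD.
have coord_inj c d x : M (x - c *: v) -> M (x - d *: v) -> c = d.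
  move=> Mc Md; apply/eqP; rewrite -subr_eq0; apply: contra_notT Mv => cd0.
  have := Mlin (-1) _ _ Mc Md; rewrite scaleN1r opprB addrA subrK -scalerBl.
  by move/(MZ (c - d)^-1); rewrite scalerA mulVf // scale1r.
pose phi x := sval (cid (coord x)).
have phiP x : M (x - phi x *: v) by rewrite /phi; case: cid.
have phi_lin : scalar phi.
  move=> c x y; apply: (coord_inj _ _ _ (phiP _)) => /=.
  by rewrite scalerDl -scalerA opprD addrACA -scalerBr; exact: Mlin.
pose L := GRing.isLinear.Build k V k _ phi phi_lin.
exists (HB.pack phi L : {scalar V}) => /=.
by apply: (coord_inj _ _ v (phiP _)); rewrite scale1r subrr.
Qed.

Lemma sweedler0 (k : fieldType) (U V W : lmodType k) (f : U -> V -> W) :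
  bilinear_for *:%R *:%R f -> sweedler 0 f = 0.
Proof.
move=> /sweedler_linear/(_ (-1) 0 0) /=.
by rewrite scaler0 addr0 scaleN1r addNr.
Qed.

Lemma ptensorM (k : fieldType) (A B : algType k) (a a' : A) (b b' : B) :
  (a ⊗ b) * (a' ⊗ b') = (a * a') ⊗ (b * b').
Proof. exact: tensor_mulE. Qed.

(** If [phi u = 1], the map induced by [phi x *: y] sends [u ⊗ v] to [v]. *)
Lemma ptensor_eq0 (k : fieldType) (U V : lmodType k) (u : U) (v : V) :
  (u ⊗ v == 0) = (u == 0) || (v == 0).
Proof.
apply/eqP/orP => [uv0|[]/eqP->]; [|exact: linear0l|exact: linear0r].
have [_|/exists_scalar_eq1[phi phiu]] := eqVneq u 0; [by left|right].
apply/eqP.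
have phiB : bilinear_for *:%R *:%R (fun (x : U) (y : V) => phi x *: y).
  split=> [y|x] c a b /=; first by rewrite linearP scalerDl -scalerA.
  by rewrite scalerDr !scalerA mulrC.
by have := sweedler_ptensor phiB u v; rewrite phiu scale1r uv0 sweedler0.
Qed.

Section TrivialHopf.
Variables (k : fieldType) (H : hopfAlgType k).

Definition counit_ground (x : H) : k^o := counit x.

Lemma counit_ground_linear : linear counit_ground.
Proof. exact: linearP. Qed.

HB.instance Definition _ :=
  GRing.isLinear.Build k H k^o _ counit_ground counit_ground_linear.

Lemma counit_ground_monoid_morphism : monoid_morphism counit_ground.
Proof. exact: counit_monoid_morphism. Qed.

HB.instance Definition _ :=
  GRing.isMonoidMorphism.Build H k^o counit_ground counit_ground_monoid_morphism.

(** This is the antipode axiom at the grouplike element [1]. *)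
Lemma antipode1 : antipode (1 : H) = 1.
Proof.
have mB : bilinear_for *:%R *:%R (fun u v : H => antipode u * v).
  split=> [y|x] c a b /=; first by rewrite linearP mulrDl -scalerAl.
  by rewrite mulrDr -scalerAr.
have := antipodel (1 : H).
rewrite (comul_monoid_morphism (s := H)).1 (counit_monoid_morphism (s := H)).1 scale1r.
by rewrite [X in X = _](sweedler_ptensor mB) mulr1.
Qed.

Lemma hopf_isomorphic_ground :
  (forall h : H, h = (counit h)%:A) -> hopf_isomorphic H k^o.
Proof.
move=> hE; exists counit_ground; split.
- exists (fun c : k^o => (c : k) *: (1 : H)) => [x|c]; first exact/esym/hE.
  rewrite /= linearZ /= /counit_ground (counit_monoid_morphism (s := H)).1.
  exact: mulr1.
- move=> x.
  have eB : bilinear_for *:%R *:%R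
      (fun u v : H => counit_ground u ⊗ counit_ground v : (k^o ⊗ k^o)%type).
    by split=> [y|y] c a b /=; rewrite linearP ?linearPl ?linearPr.
  (* The summand [0] gives the shape [c *: x + y] expected by [sweedler_linear]. *)
  have comulE : comul x = counit x *: (1 ⊗ 1) + 0.
    by rewrite {1}[x]hE linearZ /= (comul_monoid_morphism (s := H)).1 addr0.
  rewrite comulE [RHS](sweedler_linear eB) (sweedler_ptensor eB).
  rewrite /counit_ground (counit_monoid_morphism (s := H)).1.
  by rewrite sweedler0 // addr0.
- by [].
- by move=> x; rewrite [in RHS](hE x) linearZ /= antipode1 -hE.
Qed.

End TrivialHopf.

Theorem proposition3p24 (k : fieldType) (H : hopfAlgType k)
    (A : comodAlgType H) (Sbij : bijective (antipode : H -> H)) :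
  (exists t : ((A ⊗ H) ⊗ H)%type,
     is_frobenius_pair (canonical_separability A Sbij) t) ->
  hopf_isomorphic H k^o.
Proof.
case=> t [_ _ normE _]; apply: hopf_isomorphic_ground => h.
have /eqP : (1 : A) ⊗ (h - (counit h)%:A) = 0.
  rewrite linearBr linearZr_LR /= -normE; apply/eqP; rewrite subr_eq0; apply/eqP.
  transitivity ((1 ⊗ h) * \sw_(t1, t2, t3 <- t)
    ((t1 ⊗ 1) * canonical_separability A Sbij (t3 ⊗ 1) * (1 ⊗ t2))).
    rewrite normE (counit_monoid_morphism (s := H)).1 scale1r.
    by rewrite [RHS]mulr1.
  (* Left multiplication by [1 ⊗ h] passes [t1 ⊗ 1], so both sums agree term by term on the same
     representative of [t]. *)
  rewrite /sweedler mulr_sumr; apply: eq_bigr => -[t12 t3] _ /=.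
  rewrite mulr_sumr; apply: eq_bigr => -[t1 t2] _ /=.
  by rewrite !canonical_separabilityE !ptensorM !(mul1r, mulr1, mulrA).
by rewrite ptensor_eq0 oner_eq0 /= subr_eq0 => /eqP.
Qed.
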